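(* Let $S$ be the infinite binary sequence $S=S_1S_2S_3\cdots$ defined in the context. Then the worst-case compression ratio of $\mathrm{PPM}^*$ on $S$ is $0$, i.e. $$R_{\mathrm{PPM}^*}(S)=\limsup_{m\to\infty}\frac{|\mathrm{PPM}^*(S\upharpoonright m)|}{m}=0.$$
   Context: Strings are indexed from $0$; $x[i..j]$ is the substring from position $i$ to $j$ (empty if $j<i$); $x^j$ is $j$-fold concatenation; $S\upharpoonright m$ is the length-$m$ prefix of $S$; $\log$ is base $2$. de Bruijn strings: for $n\ge 1$, a de Bruijn string of order $n$ is a binary string $x$ of length $2^n$ such that every $w\in\{0,1\}^n$ occurs exactly once as a substring of $x\cdot x[0..n-2]$. $db(n)$ is the lexicographically least one, produced by Martin's algorithm: start with $x=1^{n-1}$; while possible, append a bit (preferring $0$ over $1$) so that all length-$n$ substrings of $x$ remain distinct; when no bit can be appended, delete the prefix $1^{n-1}$. For $0\le i<2^n$, $db_i(n)=db(n)[i..2^n-1]\cdot db(n)[0..i-1]$. The sequence $S$: for $n\ge1$ write $n=2^st$ with $t$ odd, let $B_{n,i}=db_i(n)^t$ for $0\le i<2^s$, $S_n=B_{n,0}B_{n,1}\cdots B_{n,2^s-1}$ (so $|S_n|=n2^n$), and $S=S_1S_2S_3\cdots$. The $\mathrm{PPM}^*$ compressor (without exclusion, with escape Method C) on binary input: after reading a prefix $x$, its model stores ''contexts'' (strings $c$), each with a frequency count for each bit $b$ equal to the number of occurrences of $cb$ as a substring of $x$, and an escape count equal to the number of distinct bits that have followed $c$ in $x$. The empty context is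 always present, and contexts are extended until unique: whenever a string $w$ occurs at least twice in $x$, the context $wb$ is stored for each bit $b$ such that $wb$ occurs in $x$ followed by a further bit (a context is only created once it has a prediction). A context is deterministic if its escape count is $1$. To encode the next bit $b$, the relevant contexts are the stored contexts that are suffixes of $x$; the current context is the shortest deterministic relevant context, or the longest relevant context if none is deterministic. If $b$ has count $f>0$ in the current context, $b$ is encoded with probability $f/(T+e)$, where $T$ is the total bit count and $e$ the escape count of that context; otherwise an escape is encoded with probability $e/(T+e)$ and the next shorter relevant context becomes current; if $b$ is unseen even in the empty context, after the escape $b$ is encoded with probability $1/2$. The model is then updated. The output $\mathrm{PPM}^*(y)$ is an arithmetic code of all these probabilities, of length $\lceil -\log P\rceil+O(1)$ (at most one bit of overhead), where $P$ is the product of all probabilities used. *)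

(* Defs.v *)
From HB Require Import structures.
From mathcomp Require Import all_boot all_order all_algebra.
From mathcomp Require Import all_classical all_reals all_analysis.
Set Implicit Arguments. Unset Strict Implicit. Unset Printing Implicit Defensive.
Import Order.TTheory GRing.Theory Num.Theory.

Definition windows (n : nat) (x : seq bool) : seq (seq bool) :=
  mkseq (fun i => take n (drop i x)) (size x + 1 - n).

Definition martin_step (n : nat) (x : seq bool) : seq bool :=
  if uniq (windows n (rcons x false)) then rcons x false
  else if uniq (windows n (rcons x true)) then rcons x true
  else x.

(* db(n): start from 1^(n-1), run the algorithm until it is stuck
   (at most 2^n appends are possible, so 2^n iterations suffice; once stuck,
   further steps are the identity), then delete the prefix 1^(n-1). *)
Definition db (n : nat) : seq bool :=
  drop n.-1 (iter (2 ^ n) (martin_step n) (nseq n.-1 true)).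

Definition dbi (n i : nat) : seq bool := rot i (db n).

Definition two_s (n : nat) : nat := logn 2 n.
Definition odd_t (n : nat) : nat := n %/ 2 ^ logn 2 n.

Definition Bblock (n i : nat) : seq bool := flatten (nseq (odd_t n) (dbi n i)).

Definition Sn (n : nat) : seq bool :=
  flatten [seq Bblock n i | i <- iota 0 (2 ^ two_s n)].

(* S |^ m : the length-m prefix of S = S_1 S_2 S_3 ...
   (each S_n, n >= 1, is nonempty, so S_1 ... S_m has length >= m) *)
Definition Sprefix (m : nat) : seq bool :=
  take m (flatten [seq Sn n | n <- iota 1 m]).

Definition occ (x w : seq bool) : nat :=
  count (fun i => take (size w) (drop i x) == w) (iota 0 (size x + 1 - size w)).

Definition freq (x c : seq bool) (b : bool) : nat := occ x (rcons c b).
Definition tot (x c : seq bool) : nat := freq x c false + freq x c true.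
Definition esc (x c : seq bool) : nat :=
  (0 < freq x c false) + (0 < freq x c true).

(* c is a stored context after reading x: the empty context, or c = w b
   with w occurring at least twice in x and w b occurring in x followed by
   a further bit *)
Definition stored (x c : seq bool) : bool :=
  if c is [::] then true
  else (1 < occ x (belast (head false c) (behead c)))
       && (0 < tot x c).

Definition deterministic (x c : seq bool) : bool := esc x c == 1.

Definition relevant (x : seq bool) : seq (seq bool) :=
  [seq c <- [seq drop (size x - l) x | l <- iota 0 (size x).+1] | stored x c].

Definition cur_index (x : seq bool) : nat :=
  let r := relevant x in
  if has (deterministic x) r then find (deterministic x) r else (size r).-1.

Definition chain (x : seq bool) : seq (seq bool) :=
  rev (take (cur_index x).+1 (relevant x)).

Section Prob.
Variable R : realType.
Local Open Scope ring_scope.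

(* escape probability e/(T+e); the only context that can ever have T+e = 0
   is the empty context before any bit is read, where escaping is certain *)
Definition esc_prob (x c : seq bool) : R :=
  if (tot x c + esc x c)%N == 0%N then 1
  else (esc x c)%:R / (tot x c + esc x c)%:R.

Fixpoint chain_prob (x : seq bool) (b : bool) (cs : seq (seq bool)) : R :=
  match cs with
  | [::] => 1 / 2
  | c :: cs' =>
      if (0 < freq x c b)%N
      then (freq x c b)%:R / (tot x c + esc x c)%:R
      else esc_prob x c * chain_prob x b cs'
  end.

Definition ppm_bitprob (x : seq bool) (b : bool) : R := chain_prob x b (chain x).

Definition ppm_prob (y : seq bool) : R :=
  \prod_(i < size y) ppm_bitprob (take i y) (nth false y i).

Definition log2 (z : R) : R := ln z / ln 2.
End Prob.

(* Main.v *)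
(* Inside S_n every bit costs O(log n): all words of length n-1 occur in
   S_(n-1), so both bits have been seen after every context of length n-2, while
   a context of length n-2 or more occurs only polynomially often in S_1 ... S_n.

   Since db(n) starts with 0^n and the rotations in S_n move only zeros, S_n is
   a sequence of repetitions 0^a w with a = n or a = n-1, where db(n) = 0^n w and
   w ends with 1^n.  The word 1^n does not occur in S_1 ... S_(n-1) and occurs
   once in each repetition.  Hence, from the second bit of w on, the context that
   starts at the last 1^n is deterministic and predicts correctly, with a count T
   equal to the number of earlier repetitions with the same a (the very first one
   excepted); the bit then costs at most log(1 + 1/T).  Over the repetitions these
   costs telescope to O(log n) per position of w, so that S_n costs O(2^n log n)
   bits while |S_n| = n 2^n. *)
Require Import Defs.
From HB Require Import structures.
From mathcomp Require Import all_boot all_order all_algebra.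
From mathcomp Require Import all_classical all_reals all_analysis.
From mathcomp Require Import zify lra.
Import Order.TTheory GRing.Theory Num.Theory.
Import numFieldNormedType.Exports.
Set Implicit Arguments. Unset Strict Implicit. Unset Printing Implicit Defensive.

(** * Counting occurrences *)

Lemma take_gt (T : eqType) (x g : seq T) p :
  size g <= size x -> size x - size g < p -> g != [::] ->
  (take (size g) (drop p x) == g) = false.
Proof.
move=> gx hp g0; apply/eqP => /(congr1 size).
rewrite size_take size_drop; have : 0 < size g by rewrite lt0n size_eq0.
case: ifP; lia.
Qed.

(** Starting positions too close to the end cannot match, so letting the position run up to [size x]
    changes nothing. The range no longer depends on [g], which permits induction on [x]. *)
Lemma occE x g :
  occ x g = count (fun p => prefix g (drop p x)) (iota 0 (size x).+1).
Proof.
rewrite /occ; under [RHS]eq_count do rewrite prefixE.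
have [->|g0] := eqVneq g [::]; first by rewrite /= subn0 addn1.
have sg : 0 < size g by rewrite lt0n size_eq0.
have [gx|gx] := leqP (size g) (size x); last first.
  have -> : size x + 1 - size g = 0 by lia.
  rewrite [LHS]/=; symmetry; apply/eqP; rewrite eqn0Ngt -has_count.
  apply/hasP => -[p _ /eqP/(congr1 size)]; rewrite size_take size_drop.
  by have := leq_subr p (size x); move: (size x - p) => q /=; case: ifP; lia.
have -> : (size x).+1 = (size x + 1 - size g) + size g by lia.
rewrite iotaD count_cat add0n [X in _ = _ + X](_ : _ = 0) ?addn0 //.
apply/eqP; rewrite eqn0Ngt -has_count; apply/hasP => -[p].
by rewrite mem_iota => /andP[hp _]; rewrite take_gt //; apply: leq_trans hp => /=; lia.
Qed.

Lemma occ_nil g : occ [::] g = (g == [::]).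
Proof. by rewrite occE; case: g. Qed.

Lemma occ_cons a x g : occ (a :: x) g = prefix g (a :: x) + occ x g.
Proof.
rewrite !occE -[iota 0 (size (a :: x)).+1]/(0 :: iota (1 + 0) (size x).+1).
by rewrite iotaDl [LHS]/= count_map.
Qed.

Lemma occ_windows x g : occ x g = count_mem g (windows (size g) x).
Proof. by rewrite /windows /mkseq count_map /occ. Qed.

Lemma occ_prefix x g : prefix g x -> 0 < occ x g.
Proof.
case: x => [|a x]; first by rewrite prefixs0 => /eqP ->; rewrite occ_nil.
by rewrite occ_cons => ->.
Qed.

Lemma occ_mono_prefix x g h : occ x (g ++ h) <= occ x g.
Proof. by rewrite !occE; apply: sub_count => p; exact: catl_prefix. Qed.

Lemma occ_mono_suffix x g h : occ x (g ++ h) <= occ x h.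
Proof.
elim: g => //= b g; apply: leq_trans.
move: (g ++ h) => c; rewrite -(leq_add2r (prefix c x)).
apply: (@leq_trans (occ x c + prefix c x)); last by [].
rewrite leq_add2r.
(* Shifting an occurrence of [b :: c] by one yields an occurrence of [c] at a nonzero position;
   [prefix c x] accounts for position 0 and carries the induction. *)
suff : occ x (b :: c) + prefix c x <= occ x c by lia.
elim: x => [|a x IH]; first by rewrite !occ_nil prefixs0 add0n.
rewrite !occ_cons prefix_cons; move: IH.
by case: (b == a); case: (prefix c (a :: x)); case: (prefix c x); lia.
Qed.

Lemma occ_small X g : size X < size g -> occ X g = 0.
Proof.
move=> h; rewrite occE; apply/eqP; rewrite -leqn0 leqNgt -has_count.
apply/hasP => -[p _ /size_prefix]; rewrite size_drop.
by have := leq_subr p (size X); move: (size X - p) => q /=; lia.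
Qed.

Lemma occ_catr X Y g : occ Y g <= occ (X ++ Y) g.
Proof. by elim: X => //= a X IH; rewrite occ_cons; lia. Qed.

Lemma occ_cat_ge X Y g : g != [::] -> occ X g + occ Y g <= occ (X ++ Y) g.
Proof.
move=> g0; elim: X => [|a X IH] /=; first by rewrite occ_nil (negbTE g0).
rewrite !occ_cons; have : prefix g (a :: X) -> prefix g (a :: X ++ Y).
  by move=> h; rewrite -cat_cons prefix_catl.
case: (prefix g (a :: X)) => [->//|_]; move: IH; lia.
Qed.

Lemma occ_catl X Y g : occ X g <= occ (X ++ Y) g.
Proof.
have [->|g0] := eqVneq g [::]; last by have := occ_cat_ge X Y g0; lia.
elim: X => [|a X IH]; first by rewrite occ_nil occ_prefix ?prefix0s.
by rewrite cat_cons !occ_cons !prefix0s ltnS.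
Qed.

Lemma occ_infix A X B g : occ X g <= occ (A ++ X ++ B) g.
Proof. exact: leq_trans (occ_catl X B g) (occ_catr A _ g). Qed.

(** An occurrence starting in [X] lies inside [X] unless fewer than [size g] letters of [X] remain;
    those last starts are counted trivially by [small]. *)
Lemma occ_cat_le X Y g : occ (X ++ Y) g <= occ X g + occ Y g + size g.
Proof.
have small : forall X, occ (X ++ Y) g <= size X + occ Y g.
  by elim=> //= a X0 IH; rewrite occ_cons; case: (prefix _ _); lia.
elim: X => [|a X IH]; first by rewrite /=; lia.
have [h|h] := ltnP (size (a :: X)) (size g); first by have := small (a :: X); lia.
rewrite /= !occ_cons.
suff -> : prefix g (a :: X ++ Y) = prefix g (a :: X) by lia.
by rewrite !prefixE -cat_cons takel_cat.
Qed.

Lemma prefix_rcons_split (u x : seq bool) :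
  prefix u x = prefix (rcons u false) x + prefix (rcons u true) x + (u == x) :> nat.
Proof.
elim: u x => [|a u IH] [|b x] //; first by case: b; rewrite !prefix_cons !prefix0s.
rewrite !rcons_cons !prefix_cons eqseq_cons.
by case: (a == b) => //=; rewrite IH.
Qed.

Lemma suffix_consr (u x : seq bool) a :
  suffix u (a :: x) = (u == a :: x) + suffix u x :> nat.
Proof.
have [->|ne] := eqVneq u (a :: x).
  rewrite suffix_refl; case h : (suffix (a :: x) x) => //.
  by move/size_suffix: h; rewrite /= ltnn.
rewrite add0n; congr nat_of_bool; apply/suffixP/suffixP => -[s e].
  case: s e => [e|b s [_ e]]; last by exists s.
  by rewrite /= in e; rewrite e eqxx in ne.
by exists (a :: s); rewrite e.
Qed.

(** Every occurrence of [u] is followed by a bit or ends [x]. Together with [occ_extl] this balances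
    the entries and exits of the vertex [u] in the de Bruijn graph. *)
Lemma occ_extr x u :
  occ x u = occ x (rcons u false) + occ x (rcons u true) + suffix u x.
Proof.
elim: x => [|a x IH]; first by rewrite !occ_nil suffixs0; case: u.
rewrite !occ_cons prefix_rcons_split IH.
by rewrite suffix_consr; lia.
Qed.

Lemma occ_extl x u : occ x u = occ x (false :: u) + occ x (true :: u) + prefix u x.
Proof.
elim: x => [|a x IH]; first by rewrite !occ_nil prefixs0.
rewrite !occ_cons !prefix_cons IH.
by case: a => /=; lia.
Qed.

Lemma occ_cat_pos A B g m : size g = m.+1 -> 0 < occ (A ++ B) g ->
  0 < occ (A ++ take m B) g \/ 0 < occ B g.
Proof.
move=> sg; elim: A => [|a A IH] /=; first by right.
rewrite occ_cons addn_gt0 lt0b => /orP[|/IH[]]; last by right.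
- move=> h; left; rewrite occ_cons addn_gt0 lt0b; apply/orP; left.
  move: h; rewrite !prefixE sg -!cat_cons => /eqP <-; apply/eqP.
  rewrite !take_cat /=; case: ifP => // _; rewrite take_takel //; lia.
- by move=> h; left; rewrite occ_cons addn_gt0 h orbT.
Qed.

(** * Martin's algorithm *)

Lemma rcons_nseq (T : Type) n (b : T) : rcons (nseq n b) b = nseq n.+1 b.
Proof. by elim: n => //= n ->. Qed.

Lemma suffix_size_inj (u v x : seq bool) :
  suffix u x -> suffix v x -> size u = size v -> u = v.
Proof. by rewrite !suffixE => /eqP eu /eqP ev e; rewrite -eu -ev e. Qed.

Lemma prefix_size_inj (u v x : seq bool) :
  prefix u x -> prefix v x -> size u = size v -> u = v.
Proof. by rewrite !prefixE => /eqP eu /eqP ev e; rewrite -eu -ev e. Qed.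

Lemma prefix_rconsr (g y : seq bool) b :
  prefix g (rcons y b) = prefix g y + (g == rcons y b) :> nat.
Proof.
elim: y g => [|c y IH] g.
  by rewrite [rcons _ _]/= prefixs1 prefixs0; case: g.
case: g => [|e g]; first by [].
by rewrite rcons_cons !prefix_cons eqseq_cons; case: (e == c) => //=; rewrite IH.
Qed.

Lemma occ_rcons x b g : g != [::] ->
  occ (rcons x b) g = occ x g + suffix g (rcons x b).
Proof.
move=> g0; elim: x => [|a x IH].
  rewrite /= occ_cons !occ_nil (negbTE g0) addn0 add0n prefixs1 (negbTE g0) /=.
  congr nat_of_bool; case: g g0 => // c [|c' g] _; first by rewrite suffixE eq_sym.
  by rewrite eqseq_cons andbF; apply/esym/negP => /size_suffix.
rewrite rcons_cons !occ_cons IH.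
by rewrite -rcons_cons prefix_rconsr rcons_cons suffix_consr; lia.
Qed.

Lemma size_windows_mem n x w : w \in windows n x -> size w = n.
Proof.
move/mapP => [i]; rewrite mem_iota => /andP[_ ilt] ->.
by rewrite size_takel // size_drop; move: ilt; rewrite add0n => ilt /=; lia.
Qed.

Lemma uniq_windowsP n x :
  uniq (windows n x) <-> (forall g, size g = n -> occ x g <= 1).
Proof.
split=> [u g gn|h]; first by rewrite occ_windows gn count_uniq_mem // leq_b1.
apply: count_mem_uniq => w.
have [win|wout] := boolP (w \in windows n x); last by apply/count_memPn.
have sw := size_windows_mem win.
apply/eqP; rewrite eqn_leq -{1}sw -occ_windows h //=.
by rewrite -has_count has_pred1.
Qed.

(* The last clause records the preference for [false]. *)
Definition martin_inv m x :=
  [/\ forall g, size g = m.+1 -> occ x g <= 1, prefix (nseq m true) x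
    & forall u, size u = m -> 0 < occ x (rcons u true) -> 0 < occ x (rcons u false)].

Definition stuck m x := forall b, ~~ uniq (windows m.+1 (rcons x b)).

Lemma last_suffix m (x : seq bool) : m <= size x ->
  exists2 u, suffix u x & size u = m.
Proof.
move=> h; exists (drop (size x - m) x); first exact: suffix_drop.
by rewrite size_drop subKn.
Qed.

(** The windows of [x] are already distinct, so a repetition can only come from the final window
    [rcons u b]. *)
Lemma nonuniq_rcons m x b u : martin_inv m x -> suffix u x -> size u = m ->
  ~~ uniq (windows m.+1 (rcons x b)) -> 0 < occ x (rcons u b).
Proof.
move=> [hu _ _] su sz; apply: contraR; rewrite -eqn0Ngt => /eqP h0.
apply/uniq_windowsP => g; case: (lastP g) => // v c.
rewrite size_rcons => -[sv]; rewrite occ_rcons; last by case: v sv.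
case h : (suffix _ _); last by rewrite addn0 hu // size_rcons sv.
move: h; rewrite suffix_rcons => /andP[/eqP -> sfx].
by rewrite (suffix_size_inj sfx su) ?h0 // sv sz.
Qed.

(** A [true] is appended only after [false] has failed, and by [nonuniq_rcons] that failure means
    that the competing word ending in [false] is already present. *)
Lemma martin_step_inv m x : martin_inv m x -> martin_inv m (martin_step m.+1 x).
Proof.
move=> inv; have [hu hp hg] := inv.
have px b : prefix (nseq m true) (rcons x b).
  by rewrite -cats1; exact: prefix_catl.
rewrite /martin_step; case: ifP => [/uniq_windowsP u0|/negbT nu].
  split=> // u su; rewrite !occ_rcons ?suffix_rcons //=; try by case: (u).
  by rewrite addn0 => /(hg _ su); lia.
case: ifP => [/uniq_windowsP u1|//].
split=> // u su; rewrite !occ_rcons ?suffix_rcons //=; try by case: (u).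
rewrite addn0 addn_gt0 => /orP[/(hg _ su)//|].
by rewrite lt0b => sx; apply: (nonuniq_rcons inv).
Qed.

Lemma martin_inv0 m : martin_inv m (nseq m true).
Proof.
split=> [g sg||u su];
  by rewrite ?prefix_refl ?occ_small // ?size_rcons ?size_nseq ?sg ?su.
Qed.

Lemma martin_iter_inv m k : martin_inv m (iter k (martin_step m.+1) (nseq m true)).
Proof.
elim: k => [|k IH]; first exact: martin_inv0.
by rewrite iterS; apply: martin_step_inv.
Qed.

Lemma martin_step_prefix n x : prefix x (martin_step n x).
Proof. by rewrite /martin_step; do 2 (case: ifP => _; rewrite ?prefix_rcons ?prefix_refl //). Qed.

Lemma martin_iter_prefix n k x : prefix x (iter k (martin_step n) x).
Proof.
elim: k => [|k IH]; first exact: prefix_refl.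
by rewrite iterS; apply: prefix_trans (martin_step_prefix _ _).
Qed.

Lemma martin_iter_size m k (x := iter k (martin_step m.+1) (nseq m true)) :
  size x = m + k \/ stuck m x.
Proof.
rewrite {}/x; elim: k => [|k IH]; first by left; rewrite size_nseq addn0.
rewrite iterS; set x := iter _ _ _ in IH *; rewrite /martin_step.
case: IH => [sx|st]; last by rewrite !(negbTE (st _)); right.
case: ifP => [_|/negbT n0]; first by left; rewrite size_rcons sx addnS.
case: ifP => [_|/negbT n1]; first by left; rewrite size_rcons sx addnS.
by right; case.
Qed.

Lemma stuck_end m x : martin_inv m x -> stuck m x ->
  suffix (nseq m true) x /\ forall b, 0 < occ x (rcons (nseq m true) b).
Proof.
move=> inv st; have [hu hp hg] := inv.
have : m <= size x by move/size_prefix: hp; rewrite size_nseq.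
move=> /last_suffix[u su sz].
have occu b : 0 < occ x (rcons u b) by apply: (nonuniq_rcons inv).
(* [u] occurs three times but has only two predecessors. *)
have pu : prefix u x.
  have := occ_extr x u; rewrite occ_extl su.
  have := occu true; have := occu false.
  have := hu (false :: u); have := hu (true :: u); rewrite /= sz.
  move=> /(_ erefl) + /(_ erefl).
  by case: (prefix u x) => //; lia.
have e : u = nseq m true by apply: prefix_size_inj pu hp _; rewrite size_nseq.
by rewrite -e.
Qed.

Lemma stuck_complete m x : martin_inv m x -> stuck m x ->
  forall g, size g = m.+1 -> 0 < occ x g.
Proof.
move=> inv st; have [hu hp hg] := inv; have [sf oc] := stuck_end inv st.
(* If [v ++ 1^(j+1)] were missing, so would be [v' ++ 1^(j+2)] with [v'] a
   shorter suffix of [v], and eventually [1^(m+1)]. *)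
have key v j : size v + j = m -> 0 < occ x (v ++ nseq j.+1 true).
  elim: v j => [|b v IH] j /=.
    by rewrite add0n => ->; have := oc true; rewrite rcons_nseq.
  move=> sv; have su : size (v ++ nseq j.+1 true) = m.
    by rewrite size_cat size_nseq; lia.
  have o1 : 0 < occ x (rcons (v ++ nseq j.+1 true) true).
    by rewrite rcons_cat rcons_nseq; apply: IH; lia.
  have o0 := hg _ su o1.
  move: su o0 o1; set u := v ++ _ => su o0 o1.
  (* [u] is left as often as it is entered, as [x] begins and ends in [1^m]. *)
  have := occ_extr x u; rewrite occ_extl.
  have -> : prefix u x = suffix u x.
    by apply/idP/idP => h; [rewrite (prefix_size_inj h hp)|rewrite (suffix_size_inj h sf)];
       rewrite ?size_nseq.
  have := hu (false :: u); have := hu (true :: u); rewrite /= su.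
  move=> /(_ erefl) + /(_ erefl).
  by case: b {sv}; lia.
(* Words ending in [true] suffice: the preference clause of the invariant supplies those ending in
   [false]. *)
have all1 u : size u = m -> 0 < occ x (rcons u true).
  by move=> su; have := key u 0; rewrite addn0 cats1; apply.
move=> g; case: (lastP g) => // u [] ; rewrite size_rcons => -[su]; first exact: all1.
exact/hg/all1.
Qed.

Lemma windows_start m k : k <= m.+1 ->
  uniq (windows m.+1 (nseq m true ++ nseq k false)).
Proof.
move=> km.
have -> : windows m.+1 (nseq m true ++ nseq k false) =
    mkseq (fun j => nseq (m - j) true ++ nseq j.+1 false) k.
  rewrite /windows size_cat !size_nseq; have -> : m + k + 1 - m.+1 = k by lia.
  apply/eq_in_map => j; rewrite mem_iota add0n => /andP[_ jk].
  rewrite drop_cat size_nseq; have [jm|mj] := ltnP j m.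
    rewrite drop_nseq take_cat size_nseq; case: ifP => [|_]; first by lia.
    have -> : m.+1 - (m - j) = j.+1 by lia.
    by rewrite take_nseq.
  have -> : j = m by lia.
  by rewrite subnn drop0 take_nseq //; lia.
(* The window at [j] has [m - j] ones with [j <= m], so the number of ones tells the windows
   apart. *)
apply: (@map_uniq _ _ (count id)); rewrite /mkseq -map_comp.
rewrite map_inj_in_uniq ?iota_uniq // => i j.
rewrite !mem_iota !add0n => /andP[_ ik] /andP[_ jk] /=.
by rewrite !count_cat /= !count_nseq /=; lia.
Qed.

Lemma martin_iter_start m k : k <= m.+1 ->
  iter k (martin_step m.+1) (nseq m true) = nseq m true ++ nseq k false.
Proof.
elim: k => [|k IH] km; first by rewrite cats0.
rewrite iterS IH; last by lia.
rewrite /martin_step -cats1 -catA cats1 rcons_nseq.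
by rewrite windows_start.
Qed.

Lemma card_words n : size [seq val t | t <- enum {: n.-tuple bool}] = 2 ^ n.
Proof. by rewrite size_map -cardE card_tuple card_bool. Qed.

Lemma mem_words n (g : seq bool) : size g = n ->
  g \in [seq val t | t <- enum {: n.-tuple bool}].
Proof.
by move=> /eqP sg; apply/mapP; exists (Tuple sg); rewrite ?mem_enum.
Qed.

Lemma db_complete m (x := iter (2 ^ m.+1) (martin_step m.+1) (nseq m true)) :
  [/\ size x = m + 2 ^ m.+1, suffix (nseq m true) x
    & forall g, size g = m.+1 -> occ x g = 1].
Proof.
have inv : martin_inv m x := martin_iter_inv m _.
have [hu hp hg] := inv; have un := (uniq_windowsP m.+1 x).2 hu.
have sm : m <= size x by move/size_prefix: hp; rewrite size_nseq.
have sw : size (windows m.+1 x) = size x - m by rewrite size_mkseq; lia.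
have sub : {subset windows m.+1 x <= [seq val t | t <- enum {: m.+1.-tuple bool}]}.
  by move=> w /size_windows_mem /mem_words.
have wn := uniq_leq_size un sub; rewrite card_words sw in wn.
have full : (forall g, size g = m.+1 -> 0 < occ x g) -> size x = m + 2 ^ m.+1.
  move=> h; suff : 2 ^ m.+1 <= size x - m by lia.
  rewrite -sw -card_words; apply: uniq_leq_size.
    by rewrite map_inj_uniq ?enum_uniq //; exact: val_inj.
  move=> w /mapP[t _ ->]; have := h (val t); rewrite size_tuple => /(_ erefl).
  by rewrite occ_windows size_tuple -has_count has_pred1.
(* If no step got stuck, the [2 ^ m.+1] appended bits have used up every word of length [m.+1], so
   any further bit repeats one. *)
have st : stuck m x.
  case: (martin_iter_size m (2 ^ m.+1)) => [sx|//]; rewrite -/x in sx.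
  have eqw : windows m.+1 x =i [seq val t | t <- enum {: m.+1.-tuple bool}].
    by apply: (uniq_min_size un sub _).2; rewrite card_words sw sx; lia.
  move=> b; apply/negP => /uniq_windowsP hb.
  have [u su sz] := last_suffix sm.
  have := hb (rcons u b); rewrite size_rcons sz => /(_ erefl).
  rewrite occ_rcons; last by case: (u).
  rewrite suffix_rcons su eqxx /= occ_windows size_rcons sz.
  have : rcons u b \in windows m.+1 x by rewrite eqw mem_words // size_rcons sz.
  by rewrite -has_pred1 has_count; case: (count _ _) => //= c; rewrite addn1.
have pos := stuck_complete inv st.
split=> [||g sg]; [exact: full|by have [] := stuck_end inv st|].
by have := hu g sg; have := pos g sg; lia.
Qed.

Lemma prefix_ones_occ n (x : seq bool) : prefix (nseq n.+1 true) x ->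
  0 < n -> 1 < occ x (nseq n true).
Proof.
case: x => // a x; rewrite [nseq _ _]/= prefix_cons => /andP[/eqP <- h] n0.
rewrite occ_cons; have -> : prefix (nseq n true) (true :: x).
  case: n n0 h => // n _; rewrite -{1}rcons_nseq => /prefixP[s ->].
  by rewrite -[nseq n.+1 true]/(true :: nseq n true) prefix_cons eqxx cat_rcons prefix_prefix.
by rewrite add1n ltnS occ_prefix.
Qed.

Lemma occ_ones2 n x : 0 < n -> 0 < occ x (nseq n.+1 true) -> 1 < occ x (nseq n true).
Proof.
move=> n0; elim: x => [|a x IH]; first by rewrite occ_nil.
rewrite occ_cons addn_gt0 lt0b => /orP[h|/IH]; first exact: prefix_ones_occ.
by rewrite occ_cons; lia.
Qed.

(* The word [1^(n-1) db(n)] lists the cyclic windows of [db(n)] linearly. *)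
Lemma db_spec n : 0 < n -> exists2 r,
    db n = nseq n false ++ r ++ nseq n true
  & size (db n) = 2 ^ n /\
    forall g, size g = n -> occ (nseq n.-1 true ++ db n) g = 1.
Proof.
case: n => // m _; rewrite /db /=.
have [sx sf o1] := db_complete m; set x := iter _ _ _ in sx sf o1 *.
have mle : m.+1 <= 2 ^ m.+1 by apply: ltnW; exact: ltn_expl.
have /prefixP[r er] : prefix (nseq m true ++ nseq m.+1 false) x.
  rewrite -martin_iter_start // /x -(subnK mle) iterD.
  exact: martin_iter_prefix.
have dE : drop m x = nseq m.+1 false ++ r.
  by rewrite er -catA drop_size_cat // size_nseq.
have xE : x = nseq m true ++ drop m x by rewrite dE er catA.
have sr : size r = 2 ^ m.+1 - m.+1.
  by have := sx; rewrite er !size_cat !size_nseq /=; lia.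
have m2 : m.+1 <= size r.
  rewrite sr; suff : 2 * m.+1 <= 2 ^ m.+1 by lia.
  by rewrite expnS leq_mul2l /= ltn_expl.
(* The single occurrence of [1^(m+1)] must end [x]: before a [false] it would create a [1^m 0] away
   from the start, and before a [true] it would give two copies of itself. *)
have su : suffix (nseq m.+1 true) x.
  have h0 : occ x (rcons (nseq m.+1 true) false) = 0.
    have := occ_extl x (rcons (nseq m true) false).
    rewrite o1 ?size_rcons ?size_nseq //.
    have -> : prefix (rcons (nseq m true) false) x.
      by rewrite er -catA /= -cat_rcons prefix_prefix.
    rewrite /=; lia.
  have h1 : occ x (rcons (nseq m.+1 true) true) = 0.
    apply/eqP; rewrite rcons_nseq eqn0Ngt; apply/negP => h.
    by have := occ_ones2 (ltn0Sn m) h; rewrite o1 ?size_nseq.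
  by have := occ_extr x (nseq m.+1 true); rewrite o1 ?size_nseq // h0 h1; case: suffix.
have : suffix (nseq m.+1 true) r.
  move: su; rewrite !suffixE er size_cat drop_cat size_nseq.
  by case: ifP => [|_]; [lia|congr (drop _ _ == _); lia].
case/suffixP => r' r'E; exists r'; first by rewrite dE r'E.
split; last by rewrite -xE.
by rewrite size_drop sx; lia.
Qed.

(** * The repetition structure of S_n *)

Definition reps (r : seq bool) (l : seq nat) : seq bool :=
  flatten [seq nseq a false ++ r | a <- l].

Arguments reps r l : simpl never.

Lemma reps_cons r a l : reps r (a :: l) = nseq a false ++ r ++ reps r l.
Proof. by rewrite /reps /= catA. Qed.

Lemma reps_nil r : reps r [::] = [::].
Proof. by []. Qed.

Lemma reps_cat r l1 l2 : reps r (l1 ++ l2) = reps r l1 ++ reps r l2.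
Proof. by rewrite /reps map_cat flatten_cat. Qed.

(** For [i <= n] the rotation is [0^(n-i) r 0^i], so the zeros ending each copy complete the zeros
    of the next, and the [i] zeros put in front complete the first. *)
Lemma rot_shift n i k (r : seq bool) : i <= n ->
  nseq i false ++ flatten (nseq k (rot i (nseq n false ++ r))) =
  reps r (nseq k n) ++ nseq i false.
Proof.
move=> ile; have rE : rot i (nseq n false ++ r) = nseq (n - i) false ++ r ++ nseq i false.
  have -> : n = i + (n - i) by lia.
  by rewrite nseqD -catA -{1}(size_nseq i false) rot_size_cat addKn catA.
elim: k => [|k IH]; first by rewrite /= cats0.
rewrite -[flatten _]/(rot i (nseq n false ++ r) ++ flatten (nseq k (rot i _))).
by rewrite {1}rE -!catA IH catA -nseqD subnKC // reps_cons -!catA.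
Qed.

Lemma two_odd n : 0 < n -> 2 ^ two_s n * odd_t n = n.
Proof.
by move=> n0; rewrite /two_s /odd_t mulnC divnK //; apply: pfactor_dvdnn.
Qed.

(** There are [2^s * t = n] repetitions. The first [j + 1] blocks end in [j] spare zeros and the
    next block starts with [n - (j + 1)], so the gap at a block border is [n - 1]; inside a block it
    is [n]. The final [e] is [2^s - 1]. *)
Lemma Sn_reps n r : 0 < n -> db n = nseq n false ++ r ->
  exists l e, [/\ Sn n = reps r (n :: l) ++ nseq e false, (size l).+1 = n,
    all (fun a => (a == n) || (a == n.-1)) l & e < n].
Proof.
move=> n0 dE; have tw := two_odd n0; set t := odd_t n in tw.
have t0 : 0 < t by case: (t) tw n0 => //; rewrite muln0 => <-.
have s0 : 0 < 2 ^ two_s n by rewrite expn_gt0.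
have sn : 2 ^ two_s n <= n by rewrite -[leqRHS]tw leq_pmulr.
suff gen j : j < 2 ^ two_s n -> exists l,
    [/\ flatten [seq Bblock n i | i <- iota 0 j.+1] = reps r (n :: l) ++ nseq j false,
     (size l).+1 = j.+1 * t & all (fun a => (a == n) || (a == n.-1)) l].
  have [|l [h1 h2 h3]] := gen (2 ^ two_s n).-1; first by rewrite prednK.
  exists l, (2 ^ two_s n).-1; rewrite prednK // in h1 h2; split=> //; last by lia.
  by rewrite h2.
elim: j => [|j IH] jlt.
  exists (nseq t.-1 n); split; last 2 first.
  - by rewrite size_nseq prednK ?mul1n.
  - by rewrite all_nseq eqxx orbT.
  rewrite /= cats0 /Bblock /dbi dE -/t.
  have := rot_shift t r (leq0n n); rewrite /= => ->.
  by rewrite -[n :: _]/(nseq t.-1.+1 n) prednK.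
have [l [h1 h2 h3]] := IH (ltnW jlt).
exists (l ++ n.-1 :: nseq t.-1 n); split; last 2 first.
- by rewrite size_cat /= size_nseq mulSn -h2; lia.
- by rewrite all_cat h3 /= eqxx orbT all_nseq eqxx orbT.
rewrite -(addn1 j.+1) iotaD map_cat flatten_cat h1 add0n.
set d := rot j.+1 (nseq n false ++ r).
have -> : flatten [seq Bblock n i | i <- iota j.+1 1] = d ++ flatten (nseq t.-1 d).
  by rewrite /= cats0 /Bblock /dbi dE -/t -/d -{1}(prednK t0).
have jn : j.+1 <= n by apply: leq_trans sn; apply: ltnW.
have := rot_shift t.-1 r jn; rewrite -/d; move: (flatten _) => F eF.
have rE : nseq j false ++ d =
    nseq n.-1 false ++ r ++ nseq j.+1 false.
  have nE : n = j.+1 + (n - j.+1) by lia.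
  rewrite /d {1}nE nseqD -catA -{1}(size_nseq j.+1 false) rot_size_cat !catA -nseqD.
  by have -> : j + (n - j.+1) = n.-1 by lia.
by rewrite -cat_cons reps_cat reps_cons -[LHS]catA [nseq j _ ++ _]catA rE -!catA eF.
Qed.

(** A run of ones cannot cross into [Y]; by the default of [head], the hypothesis covers an empty
    [Y] as well. *)
Lemma ones_prefix n v Y : head false Y = false ->
  prefix (nseq n true) (v ++ Y) = prefix (nseq n true) v.
Proof.
move=> hY; elim: n v => [|n IH] [|a v]; rewrite ?prefix0s //.
  by case: Y hY {IH} => [|[] Y].
by rewrite cat_cons -[nseq _.+1 _]/(true :: nseq n true) !prefix_cons IH.
Qed.

Lemma occ_ones_cat n X Y : head false Y = false ->
  occ (X ++ Y) (nseq n.+1 true) = occ X (nseq n.+1 true) + occ Y (nseq n.+1 true).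
Proof.
move=> hY; elim: X => [|a X IH]; first by rewrite occ_nil.
by rewrite cat_cons !occ_cons IH -cat_cons ones_prefix // addnA.
Qed.

Lemma occ_noones n X Y g : head false Y = false -> occ X (nseq n.+1 true) = 0 ->
  occ (X ++ Y) (nseq n.+1 true ++ g) = occ Y (nseq n.+1 true ++ g).
Proof.
move=> hY; elim: X => [|a X IH] //.
rewrite cat_cons !occ_cons => /eqP; rewrite addn_eq0 => /andP[pf /eqP/IH ->].
case h : (prefix _ _) => //; move: pf; move/catl_prefix: h.
by rewrite -cat_cons ones_prefix // => ->.
Qed.

Lemma occ_zeros a Y g : occ (nseq a false ++ Y) (true :: g) = occ Y (true :: g).
Proof. by elim: a => //= a IH; rewrite occ_cons prefix_cons /= IH. Qed.

(** The first word has its only run [1^(n+1)] at its end, so it contributes exactly when [g] starts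
    [Y]. *)
Lemma occ_end_ones n r Y g : head false Y = false ->
  occ (r ++ nseq n.+1 true) (nseq n.+1 true) = 1 ->
  occ ((r ++ nseq n.+1 true) ++ Y) (nseq n.+1 true ++ g) =
  prefix g Y + occ Y (nseq n.+1 true ++ g).
Proof.
move=> hY; elim: r => [|a r IH] h1.
  rewrite cat0s; set N := nseq n.+1 true.
  transitivity (prefix (N ++ g) (N ++ Y) + occ (nseq n true ++ Y) (N ++ g)).
    exact: occ_cons.
  rewrite prefix_catr // eqxx; congr (_ + _).
  by rewrite occ_noones // occ_small // !size_nseq.
have pos : 0 < occ (r ++ nseq n.+1 true) (nseq n.+1 true).
  exact: leq_trans (occ_prefix (prefix_refl _)) (occ_catr _ _ _).
move: h1; rewrite cat_cons occ_cons => h1.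
have pf : prefix (nseq n.+1 true) (a :: r ++ nseq n.+1 true) = false.
  by move: h1 pos; case: prefix; lia.
rewrite cat_cons occ_cons IH; last by move: h1; rewrite pf.
rewrite -[RHS]add0n; congr (_ + _).
apply/eqP; rewrite eqb0; apply/negP => /catl_prefix.
by rewrite -cat_cons ones_prefix // pf.
Qed.

Lemma head_reps r l : all (leq 1) l -> head false (reps r l) = false.
Proof. by case: l => [//|[|a] l]. Qed.

Lemma prefix_zeros a b u v :
  prefix (nseq a false ++ true :: u) (nseq b false ++ true :: v) ->
  a = b /\ prefix u v.
Proof.
by elim: a b => [|a IH] [|b] //= h; have [-> ?] := IH _ h.
Qed.

(** An occurrence must start at the marker [1^(n+1)] ending some [w], followed by a gap [0^d]. As
    [w] begins with [true] and [0 < q], the length of the zero run forces [a = d]; position [q] of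
    the next [w] then contradicts [b]. *)
Lemma occ_reps_conflict n r l a q b (w := r ++ nseq n.+1 true) :
  head false w -> occ w (nseq n.+1 true) = 1 -> all (leq 1) l ->
  0 < q < size w -> b != nth false w q ->
  occ (reps w l) (nseq n.+1 true ++ nseq a false ++ rcons (take q w) b) = 0.
Proof.
move=> hw o1 + /andP[q0 qw] nb; elim: l => [|c l IH] /=; first by rewrite occ_nil.
move=> /andP[_ hl]; rewrite reps_cons occ_zeros occ_end_ones ?head_reps // IH // addn0.
apply/eqP; rewrite eqb0; apply/negP.
case: l hl {IH} => [|d l] hl; first by rewrite prefixs0; case: (a) (take q w) => [|?] [].
have wE : w = true :: behead w by case: (w) hw => [|[]].
case: q q0 qw nb => // q _ qw nb; rewrite reps_cons.
rewrite {1 2}wE /= => /prefix_zeros[_] /prefixP[s].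
move/(congr1 (nth false ^~ q)).
have sb : q < size (behead w) by rewrite size_behead; lia.
rewrite nth_cat sb cat_rcons nth_cat size_takel ?(ltnW sb) // ltnn subnn /=.
by rewrite nth_behead => e; rewrite e eqxx in nb.
Qed.

(** Each closing [N] is regrouped with the repetition after it, so every entry [a] of [l] supplies
    an occurrence of its own. *)
Lemma occ_reps_ge (N r : seq bool) (a k : nat) (l : seq nat) Y : N != [::] -> k <= size r ->
  count_mem a l <= occ (N ++ reps (r ++ N) l ++ Y) (N ++ nseq a false ++ take k r).
Proof.
move=> N0 kr; elim: l => // c l IH; rewrite reps_cons.
have -> : N ++ (nseq c false ++ (r ++ N) ++ reps (r ++ N) l) ++ Y =
   (N ++ nseq c false ++ r) ++ (N ++ reps (r ++ N) l ++ Y) by rewrite -!catA.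
apply: leq_trans (occ_cat_ge _ _ _); last by case: (N) N0.
rewrite [count _ _]/=; apply: leq_add IH.
case: (c =P a) => [->|_ //]; apply: occ_prefix.
by rewrite -{2}(cat_take_drop k r) !catA prefix_prefix.
Qed.

(** * Occurrences in S_1 ... S_n *)

(** Had [w] begun with [false], the word [0^(m+1)] would occur twice in [db m.+1]. *)
Lemma db_data m : exists r (w := r ++ nseq m.+1 true),
  [/\ db m.+1 = nseq m.+1 false ++ w, head false w,
      occ w (nseq m.+1 true) = 1, m.+1 + size w = 2 ^ m.+1
    & forall g, size g = m.+1 ->
      0 < occ (nseq m true ++ db m.+1) g /\ occ (db m.+1) g <= 1].
Proof.
have [r dE [sd o1]] := db_spec (ltn0Sn m); exists r => w; rewrite -/w in dE.
have le1 g : size g = m.+1 -> occ (db m.+1) g <= 1.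
  by move=> /o1 <-; exact: occ_catr.
split=> //.
- case wE : w => [|[] w'] //; first by move: wE; rewrite /w; case: (r).
  have := le1 (nseq m.+1 false); rewrite size_nseq => /(_ erefl).
  rewrite dE wE; have e : nseq m.+1 false ++ false :: w' =
      false :: nseq m.+1 false ++ w' by rewrite -cat_rcons rcons_nseq.
  rewrite e occ_cons -e prefix_prefix add1n ltnS leqNgt occ_prefix //.
  exact: prefix_prefix.
- have := le1 (nseq m.+1 true); rewrite size_nseq => /(_ erefl) h.
  have h1 : occ w (nseq m.+1 true) <= 1 by apply: leq_trans h; rewrite dE occ_catr.
  apply/eqP; rewrite eqn_leq h1 /=.
  exact: leq_trans (occ_prefix (prefix_refl _)) (occ_catr _ _ _).
- by rewrite -sd dE size_cat size_nseq.
- by move=> g sg; rewrite o1 // le1.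
Qed.

Lemma head_Sn n : 0 < n -> head false (Sn n) = false.
Proof.
case: n => // m _; have [r [dE _ _ _ _]] := db_data m.
by have [l [e [-> _ _ _]]] := Sn_reps (ltn0Sn m) dE.
Qed.

Lemma occ_more_ones w i n : 0 < i < n -> occ w (nseq i true) = 1 ->
  occ w (nseq n true) = 0.
Proof.
move=> /andP[i0 lin] o1; apply/eqP; rewrite eqn0Ngt; apply/negP => h.
have h1 : 0 < occ w (nseq i.+1 true).
  by apply: leq_trans h _; rewrite -(subnKC lin) nseqD occ_mono_prefix.
by have := occ_ones2 i0 h1; rewrite o1.
Qed.

(** For [n = 1] the list [l] is empty, so a gap [n.-1 = 0] never arises. *)
Lemma all_reps n l : 0 < n -> (size l).+1 = n ->
  all (fun a => (a == n) || (a == n.-1)) l -> all (leq 1) (n :: l).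
Proof.
move=> n0 sl /allP al; rewrite /= n0; apply/allP => a al'.
case: l sl al' al => [//|b l] /= sl al' /(_ _ al') /orP[] /eqP ->; lia.
Qed.

Lemma Sn_noones i n : 0 < i < n -> occ (Sn i) (nseq n true) = 0.
Proof.
case: i => // i; case: n => // n ilt; have [r [dE hw o1 _ _]] := db_data i.
have [l [e [-> sl al _]]] := Sn_reps (ltn0Sn i) dE.
have {al}al := all_reps (ltn0Sn i) sl al.
have ow := occ_more_ones ilt o1.
have he : head false (nseq e false) = false by case: (e).
rewrite occ_ones_cat // -[nseq e _]cats0 occ_zeros occ_nil addn0.
elim: (_ :: l) al => [_|a k IH /andP[_ ak]]; first by rewrite occ_nil.
by rewrite reps_cons occ_zeros occ_ones_cat ?head_reps // ow IH.
Qed.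

Definition Sinit n : seq bool := flatten [seq Sn i | i <- iota 1 n].

Lemma SinitS n : Sinit n.+1 = Sinit n ++ Sn n.+1.
Proof. by rewrite /Sinit -(addn1 n) iotaD map_cat flatten_cat /= cats0 add1n addn1. Qed.

Lemma Sinit_noones n N : n < N -> occ (Sinit n) (nseq N true) = 0.
Proof.
elim: n => [|n IH] nN; first by rewrite occ_nil; case: N nN.
rewrite SinitS; case: N IH nN => // N IH nN.
by rewrite occ_ones_cat ?head_Sn // IH 1?ltnW // Sn_noones.
Qed.

(** A cyclic window of [db m] lies inside [db m] or straddles its border. The straddling ones are
    read across the first two repetitions, as the second begins with at least [m - 1] zeros; [1 < m]
    provides a second repetition. *)
Lemma Sn_words m g : 1 < m -> size g = m -> 0 < occ (Sn m) g.
Proof.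
case: m => // m m0 sg; have [r [dE hw o1 _ og]] := db_data m.
have [[|a l] [e [-> sl al _]]] := Sn_reps (ltn0Sn m) dE; first by move: sl m0 => [<-].
have aE : exists b, a = m + b.
  by move: al => /andP[/orP[] /eqP -> _]; [exists 1; rewrite addn1|exists 0; rewrite addn0].
case: aE => b aE; rewrite reps_cons catA -dE reps_cons aE nseqD -!catA.
set Y := (nseq b false ++ _).
have [/(occ_cat_pos sg)[h|h] _] := og g sg; last exact: leq_trans h (occ_catl _ _ _).
rewrite dE in h *.
have tE : take m (nseq m.+1 false ++ r ++ nseq m.+1 true) = nseq m false.
  by rewrite -rcons_nseq cat_rcons take_size_cat // size_nseq.
rewrite tE in h; apply: (leq_trans h).
have -> : (nseq m.+1 false ++ r ++ nseq m.+1 true) ++ nseq m false ++ Y =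
  (nseq m.+1 false ++ r ++ [:: true]) ++ (nseq m true ++ nseq m false) ++ Y by rewrite -!catA.
exact: occ_infix.
Qed.

(** Induction on the number [k] of missing bits: by [occ_extr] a count is at most the sum of the two
    extended counts plus one, giving the bounds 1, 3, 7 and so on. *)
Lemma occ_db_short n g k : 0 < n -> size g + k = n -> occ (db n) g < 2 ^ k.+1.
Proof.
case: n => // m _; have [r [_ _ _ _ og]] := db_data m.
elim: k g => [|k IH] g sg; first by rewrite expn1 ltnS; apply: (og _ _).2; lia.
have h b : occ (db m.+1) (rcons g b) < 2 ^ k.+1 by apply: IH; rewrite size_rcons; lia.
rewrite occ_extr; have := h true; have := h false; rewrite [2 ^ k.+2]expnS.
by case: suffix; lia.
Qed.

Lemma occ_db_le7 n i g : 0 < i <= n.+2 -> size g = n -> occ (db i) g <= 7.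
Proof.
move=> /andP[i0 ile] sg; have [ig|gi] := leqP i (size g).
  rewrite -(cat_take_drop i g); apply: leq_trans (occ_mono_prefix _ _ _) _.
  have := @occ_db_short i (take i g) 0 i0; rewrite size_takel // addn0 => /(_ erefl).
  by rewrite expn1; lia.
have := @occ_db_short i g (i - size g) i0; rewrite (subnKC (ltnW gi)) => /(_ erefl).
have : 2 ^ (i - size g).+1 <= 2 ^ 3 by rewrite leq_exp2l //; lia.
rewrite -[2 ^ 3]/8; lia.
Qed.

Lemma occ_flatten_le (ss : seq (seq bool)) (g : seq bool) B : g != [::] ->
  (forall x, x \in ss -> occ x g <= B) ->
  occ (flatten ss) g <= size ss * (B + size g).
Proof.
move=> g0; elim: ss => [|x ss IH] h /=; first by rewrite occ_nil (negbTE g0).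
have h1 := h x (mem_head _ _).
have h2 : occ (flatten ss) g <= size ss * (B + size g).
  by apply: IH => y yss; apply: h; rewrite inE yss orbT.
by have := occ_cat_le x (flatten ss) g; rewrite mulSn; lia.
Qed.

(** A rotation consists of two pieces of [db i], hence [7 + 7]. Each of the three concatenations
    (pieces of a rotation, copies in a block, blocks) adds at most [n] per border, and
    [2^s * t = i]. *)
Lemma occ_Sn_le n i (g : seq bool) : 0 < i <= n.+2 -> size g = n -> g != [::] ->
  occ (Sn i) g <= i * (14 + 3 * n).
Proof.
move=> hi sg g0; have /andP[i0 _] := hi; have d7 := occ_db_le7 hi sg.
have rb j : occ (dbi i j) g <= 14 + n.
  rewrite /dbi /rot; apply: leq_trans (occ_cat_le _ _ _) _.
  have h1 : occ (drop j (db i)) g <= occ (db i) g.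
    by rewrite -{2}(cat_take_drop j (db i)) occ_catr.
  have h2 : occ (take j (db i)) g <= occ (db i) g.
    by rewrite -{2}(cat_take_drop j (db i)) occ_catl.
  by rewrite sg; lia.
have bb j : occ (Bblock i j) g <= odd_t i * (14 + 2 * n).
  have := @occ_flatten_le (nseq (odd_t i) (dbi i j)) g (14 + n) g0.
  rewrite size_nseq sg => h; apply: leq_trans (h _) _; last by rewrite leq_mul2l; lia.
  by move=> x /nseqP[-> _].
have := @occ_flatten_le [seq Bblock i j | j <- iota 0 (2 ^ two_s i)] g _ g0.
move=> /(_ (odd_t i * (14 + 2 * n))) h.
apply: leq_trans (h _) _; first by move=> x /mapP[j _ ->].
have t0 : 0 < odd_t i by have := two_odd i0; case: (odd_t i) => //; lia.
rewrite size_map size_iota sg; move: (two_odd i0) t0.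
by move: (2 ^ _) (odd_t i) => p t <- t0; nia.
Qed.

(** Majorizes the occurrences of a nonempty word of length [n - 2] in [Sinit n]: [n] words [Sn i],
    at most [n * (14 + 3 * n)] occurrences in each and at most [n] across each border. *)
Definition count_bound n := n * (n * (14 + 3 * n) + n).

Lemma occ_Sinit_le n (g : seq bool) : size g = n -> g != [::] ->
  occ (Sinit n.+2) g <= count_bound n.+2.
Proof.
move=> sg g0; have := @occ_flatten_le [seq Sn i | i <- iota 1 n.+2] g _ g0.
move=> /(_ (n.+2 * (14 + 3 * n))) h; apply: leq_trans (h _) _.
  move=> x /mapP[i]; rewrite mem_iota => hi ->.
  apply: leq_trans (occ_Sn_le _ sg g0) _; first by lia.
  by rewrite leq_mul2r; lia.
rewrite size_map size_iota sg /count_bound leq_mul2l; apply/orP; right; nia.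
Qed.

Lemma size_Sn n : 0 < n -> size (Sn n) = n * 2 ^ n.
Proof.
move=> n0; have sd : size (db n) = 2 ^ n.
  by case: n n0 => // m _; have [r [-> _ _ <- _]] := db_data m; rewrite size_cat size_nseq.
have sb j : size (Bblock n j) = odd_t n * 2 ^ n.
  by rewrite /Bblock; elim: (odd_t n) => //= t IH; rewrite size_cat IH size_rot sd mulSn.
have gen k l : size (flatten [seq Bblock n i | i <- iota k l]) = l * (odd_t n * 2 ^ n).
  by elim: l k => //= l IH k; rewrite size_cat sb IH mulSn.
by rewrite /Sn gen mulnA two_odd.
Qed.

(** * Bit probabilities *)

(** A suffix of [x] that also has a successor occurs at least twice in [x], and so does the word
    obtained by removing its last bit. *)
Lemma stored_suffix x c : suffix c x -> 0 < tot x c -> stored x c.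
Proof.
case: c => // a c sc t0; rewrite /stored t0 andbT /=.
have : 1 < occ x (a :: c) by rewrite occ_extr sc; move: t0; rewrite /tot /freq; lia.
by move/leq_trans; apply; rewrite lastI -cats1 occ_mono_prefix.
Qed.

Lemma stored_tot x c : stored x c -> c = [::] \/ 0 < tot x c.
Proof. by case: c => [|a c]; [left|move=> /andP[_]; right]. Qed.

Lemma sorted_relevant x : sorted (@suffix bool) (relevant x).
Proof.
apply: sorted_filter; first exact: suffix_trans.
apply: (@homo_sorted _ _ _ leq) (iota_sorted 0 _) => l l' ll'.
have -> : size x - l = (l' - l - (l' - size x)) + (size x - l') by lia.
by rewrite -drop_drop suffix_drop.
Qed.

Lemma suffix_relevant x i j : i <= j < size (relevant x) ->
  suffix (nth [::] (relevant x) i) (nth [::] (relevant x) j).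
Proof.
move=> /andP[ij js].
apply: (sorted_leq_nth (@suffix_trans _) (@suffix_refl _)) => //; last first.
  exact: leq_ltn_trans js.
exact: sorted_relevant.
Qed.

Lemma mem_relevant (x c : seq bool) : suffix c x -> 0 < tot x c -> c \in relevant x.
Proof.
move=> sc t0; rewrite mem_filter stored_suffix // andTb; apply/mapP.
exists (size c); first by rewrite mem_iota /= add0n ltnS size_suffix.
by move: sc; rewrite suffixE => /eqP.
Qed.

Lemma freq_suffix x c c' b : suffix c' c -> freq x c b <= freq x c' b.
Proof. by move=> /suffixP[s ->]; rewrite /freq -!cats1 -catA occ_mono_suffix. Qed.

Lemma tot_suffix x c c' : suffix c' c -> tot x c <= occ x c'.
Proof.
move=> /suffixP[s ->]; apply: leq_trans (occ_mono_suffix _ s _).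
by rewrite [occ _ _]occ_extr /tot /freq leq_addr.
Qed.

Lemma chainE x i : cur_index x = i -> i < size (relevant x) ->
  chain x = nth [::] (relevant x) i :: rev (take i (relevant x)).
Proof. by move=> e h; rewrite /chain e (take_nth [::]) // rev_rcons. Qed.

Section BitProb.
Variable R : realType.
Local Open Scope ring_scope.

(** The current context is the shortest deterministic one, hence a suffix of [c]. It has seen [b] at
    least [T] times, so [b] is its only successor, and [f / (f + 1)] increases with [f]. *)
Lemma ppm_bitprob_det x c b T : suffix c x -> (0 < T <= freq x c b)%N ->
  freq x c (~~ b) = 0%N -> T%:R / T.+1%:R <= ppm_bitprob R x b.
Proof.
move=> sc /andP[T0 Tf] f0.
have t0 : (0 < tot x c)%N by move: T0 Tf f0; rewrite /tot; case: (b) => /=; lia.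
have cr := mem_relevant sc t0.
have dc : deterministic x c.
  by rewrite /deterministic /esc; move: T0 Tf f0; case: (b) => /= *; apply/eqP; lia.
have hd : has (deterministic x) (relevant x) by apply/hasP; exists c.
set i := find (deterministic x) (relevant x).
have ilt : (i < size (relevant x))%N by rewrite -has_find.
have ij : (i <= index c (relevant x))%N.
  rewrite leqNgt; apply/negP => /(before_find [::]).
  by rewrite nth_index // dc.
have si : suffix (nth [::] (relevant x) i) c.
  by rewrite -[X in suffix _ X](nth_index [::] cr) suffix_relevant // ij index_mem.
have := nth_find [::] hd; rewrite -/i /ppm_bitprob (chainE _ ilt); last by rewrite /cur_index hd.
move: si; move: (nth _ _ i) => c' si /eqP e1.
have f1 := leq_trans Tf (freq_suffix x b si).
have tE : tot x c' = freq x c' b.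
  by move: e1 f1 T0; rewrite /esc /tot; case: (b) => /=; lia.
rewrite /= (leq_trans T0 f1) e1 tE addn1.
rewrite ler_pdivrMr ?ltr0Sn // mulrAC ler_pdivlMr ?ltr0Sn //.
by rewrite -!natrM ler_nat; lia.
Qed.

Lemma freq_nondet x c u b : stored x c -> ~~ deterministic x c ->
  suffix u c -> (forall b', 0 < freq x u b')%N -> (0 < freq x c b)%N.
Proof.
move=> /stored_tot[->|t0]; first by move=> _; rewrite suffixs0 => /eqP ->.
by move=> + _ _; rewrite /deterministic /esc; move: t0; rewrite /tot; case: b; lia.
Qed.

(** No suffix of [u] is deterministic, so coding starts at a context ending in [u], whose
    denominator is at most [K + 2]. A deterministic one may force an escape, but the next shorter
    relevant context still ends in [u], is not deterministic and has seen both bits. Hence there are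
    at most two factors. *)
Lemma ppm_bitprob_ge x u b K : suffix u x -> (forall b', 0 < freq x u b')%N ->
  (occ x u <= K)%N -> (K.+2 ^ 2)%:R^-1 <= ppm_bitprob R x b.
Proof.
move=> su fu uK.
have t0 : (0 < tot x u)%N by have := fu true; rewrite /tot; lia.
have ur := mem_relevant su t0.
set j := index u (relevant x).
have jlt : (j < size (relevant x))%N by rewrite index_mem.
have uE : nth [::] (relevant x) j = u by rewrite nth_index.
have nu c : suffix c u -> ~~ deterministic x c.
  move=> cu; have h b' := leq_trans (fu b') (freq_suffix x b' cu).
  by have := h true; have := h false; rewrite /deterministic /esc; lia.
have ju i : (j <= i < size (relevant x))%N -> suffix u (nth [::] (relevant x) i).
  by move=> h; rewrite -uE suffix_relevant.
have st i : (i < size (relevant x))%N -> stored x (nth [::] (relevant x) i).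
  by move=> h; have := mem_nth [::] h; rewrite mem_filter => /andP[].
have esc2 c : (esc x c <= 2)%N by rewrite /esc; lia.
have good c : suffix u c -> (0 < freq x c b)%N ->
    K.+2%:R^-1 <= (freq x c b)%:R / (tot x c + esc x c)%:R :> R.
  move=> uc fc; have tK := leq_trans (tot_suffix x uc) uK.
  have tpos : (0 < tot x c)%N by move: fc; rewrite /tot; case: (b); lia.
  rewrite -[X in X <= _]mul1r ler_pM ?invr_ge0 ?ler0n ?ler1n //.
  rewrite lef_pV2 ?posrE ?ltr0n //; last by lia.
  by rewrite ler_nat; have := esc2 c; lia.
have K1 : (K.+2 ^ 2)%:R^-1 <= K.+2%:R^-1 :> R.
  by rewrite lef_pV2 ?posrE ?ltr0n // ler_nat; nia.
set i := cur_index x.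
have [hd|nd] := boolP (has (deterministic x) (relevant x)); last first.
  have iE : i = (size (relevant x)).-1 by rewrite /i /cur_index (negbTE nd).
  have ilt : (i < size (relevant x))%N by rewrite iE; lia.
  have uc : suffix u (nth [::] (relevant x) i) by apply: ju; rewrite ilt iE; lia.
  rewrite /ppm_bitprob (chainE erefl ilt) -/i /=.
  have fc : (0 < freq x (nth [::] (relevant x) i) b)%N.
    apply: (freq_nondet b (st _ ilt) _ uc fu).
    by apply: (hasPn nd); apply: mem_nth.
  by rewrite fc (le_trans K1) ?good.
have iE : i = find (deterministic x) (relevant x) by rewrite /i /cur_index hd.
have ilt : (i < size (relevant x))%N by rewrite iE -has_find.
have di : deterministic x (nth [::] (relevant x) i) by rewrite iE nth_find.
have ji : (j < i)%N.
  rewrite ltnNge; apply/negP => ij.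
  by move: di; apply/negP/nu; rewrite -[X in suffix _ X]uE suffix_relevant // ij.
have uc : suffix u (nth [::] (relevant x) i) by apply: ju; rewrite ilt ltnW.
rewrite /ppm_bitprob (chainE erefl ilt) -/i /=.
case: ifP => [fc|_]; first by rewrite (le_trans K1) ?good.
have ilt' : (i.-1 < size (relevant x))%N by lia.
have -> : take i (relevant x) =
    rcons (take i.-1 (relevant x)) (nth [::] (relevant x) i.-1).
  by rewrite -take_nth // (ltn_predK ji).
rewrite rev_rcons /=.
have uc' : suffix u (nth [::] (relevant x) i.-1) by apply: ju; rewrite ilt'; lia.
have fc' : (0 < freq x (nth [::] (relevant x) i.-1) b)%N.
  apply: (freq_nondet b (st _ ilt') _ uc' fu).
  by rewrite (before_find [::]) // -iE; lia.
rewrite fc' expnS expn1 natrM invfM ler_pM ?invr_ge0 ?ler0n ?good //.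
move: uc di; move: (nth _ _ i) => c uc /eqP e1.
rewrite /esc_prob e1 addn1 /= mul1r lef_pV2 ?posrE ?ltr0n // ler_nat.
by rewrite ltnS; apply: leqW; apply: leq_trans (tot_suffix x uc) uK.
Qed.

Lemma esc_prob_ge0 x c : 0 < esc_prob R x c <= 1.
Proof.
rewrite /esc_prob; case: ifP => [|/eqP h]; first by rewrite ltr01 lexx.
have e0 : (0 < esc x c)%N by move: h; rewrite /esc /tot; lia.
rewrite divr_gt0 ?ltr0n //=; last by lia.
by rewrite ler_pdivrMr ?ltr0n ?mul1r ?ler_nat; lia.
Qed.

Lemma chain_prob_bounds x b cs : 0 < chain_prob R x b cs <= 1.
Proof.
elim: cs => [|c cs /andP[h0 h1]] /=; first by apply/andP; split; lra.
case: ifP => [f0|_].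
  have ft : (freq x c b <= tot x c)%N by rewrite /tot; case: (b); lia.
  rewrite divr_gt0 ?ltr0n //=; last by lia.
  by rewrite ler_pdivrMr ?ltr0n ?mul1r ?ler_nat; lia.
have /andP[e0 e1] := esc_prob_ge0 x c.
by rewrite mulr_gt0 //= mulr_ile1 // ltW.
Qed.

End BitProb.

(** * The cost of S_n *)

Section CondProb.
Variable R : realType.
Local Open Scope ring_scope.

Fixpoint ppm_cond (X Y : seq bool) : R :=
  if Y is b :: Y' then ppm_bitprob R X b * ppm_cond (rcons X b) Y' else 1.

Lemma ppm_cond_cat X Y Z :
  ppm_cond X (Y ++ Z) = ppm_cond X Y * ppm_cond (X ++ Y) Z.
Proof.
elim: Y X => [|b Y IH] X /=; first by rewrite mul1r cats0.
by rewrite IH cat_rcons mulrA.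
Qed.

Lemma ppm_probE Y : ppm_prob R Y = ppm_cond [::] Y.
Proof.
suff gen X : ppm_cond X Y =
    \prod_(i < size Y) ppm_bitprob R (X ++ take i Y) (nth false Y i) by rewrite gen.
elim: Y X => [|b Y IH] X; first by rewrite big_ord0.
rewrite big_ord_recl /= cats0 IH; congr (_ * _); apply: eq_bigr => i _.
by rewrite cat_rcons.
Qed.

Lemma ppm_cond_bounds X Y : 0 < ppm_cond X Y <= 1.
Proof.
elim: Y X => [|b Y IH] X /=; first by rewrite ltr01 lexx.
have /andP[h0 h1] := chain_prob_bounds R X b (chain X).
have /andP[g0 g1] := IH (rcons X b).
by rewrite mulr_gt0 //= mulr_ile1 // ltW.
Qed.

Lemma ppm_cond_ge X Y g : 0 <= g ->
  (forall Y1 b Y2, Y = Y1 ++ b :: Y2 -> g <= ppm_bitprob R (X ++ Y1) b) ->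
  g ^+ size Y <= ppm_cond X Y.
Proof.
move=> g0; elim: Y X => [|b Y IH] X h //=; rewrite exprS.
apply: ler_pM; rewrite ?exprn_ge0 //; first by rewrite -[X]cats0; apply: h.
by apply: IH => Y1 c Y2 e; rewrite cat_rcons; apply: (h _ _ Y2); rewrite e.
Qed.

Definition bit_bound n : R := ((count_bound n).+2 ^ 2)%:R^-1.

Lemma bit_bound_bounds n : 0 < bit_bound n <= 1.
Proof.
rewrite /bit_bound invr_gt0 ltr0n expn_gt0 /=.
by rewrite invf_le1 ?ltr0n ?expn_gt0 // ler1n expn_gt0.
Qed.

Section Block.
Variables (m : nat) (m2 : (1 < m)%N).
Let n := m.+1.
Let G := bit_bound n.
Let N := (2 ^ n)%N.

(** [ppm_bitprob_ge] is applied to the suffix [u] of length [n - 2]: both its extensions have length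
    [m], so they occur in [Sn m], which has been read. *)
Lemma ppm_bitprob_Sn Y1 b Y2 : Sn n = Y1 ++ b :: Y2 ->
  G <= ppm_bitprob R (Sinit m ++ Y1) b.
Proof.
move=> e; set x := Sinit m ++ Y1; have k1 : m = m.-1.+1 by lia.
have sx : (m.-1 <= size x)%N.
  have m0 : (0 < m)%N by lia.
  rewrite /x size_cat {1 2}k1 SinitS size_cat -k1 (size_Sn m0).
  have : (m * 1 <= m * 2 ^ m)%N by rewrite leq_mul2l expn_gt0 orbT.
  lia.
have [u su sz] := last_suffix sx.
apply: (@ppm_bitprob_ge R x u b (count_bound n)) => // [b'|].
  apply: (@leq_trans (occ (Sn m) (rcons u b'))).
    by apply: Sn_words => //; rewrite size_rcons sz; lia.
  by rewrite /freq /x {2}k1 SinitS -k1 -catA occ_infix.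
apply: (@leq_trans (occ (Sinit n) u)).
  by rewrite /n SinitS -/n e catA occ_catl.
rewrite /n {1 2}k1; apply: (occ_Sinit_le sz).
by case: u sz {su} => //=; lia.
Qed.

Variables (r : seq bool).
Let w := r ++ nseq n true.
Hypothesis (hw : head false w)
  (o1 : occ w (nseq n true) = 1%N) (sw : (n + size w = N)%N).

(** The leading [n] is the first repetition of [S_n]. It stays outside [l] because no [1^n] precedes
    it, so it does not train the contexts that start at [1^n]. *)
Definition rep_context l := Sinit m ++ reps w (n :: l).

(** The context is [1^n] followed by what has been read of the current repetition. Each repetition
    in [l1] with the same gap counts for the right bit, and [occ_reps_conflict] excludes the wrong
    one. *)
Lemma ppm_bitprob_rep l1 a q : all (leq 1) (rcons l1 a) ->
  (0 < count_mem a l1)%N -> (0 < q < size r)%N ->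
  (count_mem a l1)%:R / (count_mem a l1).+1%:R <=
  ppm_bitprob R (rep_context l1 ++ nseq a false ++ take q r) (nth false r q).
Proof.
move=> al T0 /andP[q0 qr]; set x := _ ++ nseq a false ++ _; set b := nth _ _ _.
have qw : (q < size w)%N by rewrite size_cat ltn_addr.
have tw : take q w = take q r by rewrite takel_cat // ltnW.
have bw : nth false w q = b by rewrite nth_cat qr.
have ctxE : rep_context l1 = (Sinit m ++ nseq n false ++ r) ++ nseq n true ++ reps w l1.
  by rewrite /rep_context reps_cons /w -!catA.
have cE : exists s, rep_context l1 = s ++ nseq n true.
  rewrite /rep_context; case/lastP: l1 {al T0 x ctxE} => [|l a'].
    by exists (Sinit m ++ nseq n false ++ r); rewrite reps_cons reps_nil /w -!catA cats0.
  exists (Sinit m ++ reps w (n :: l) ++ nseq a' false ++ r).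
  by rewrite -rcons_cons -cats1 reps_cat (reps_cons _ a') reps_nil /w -!catA cats0.
set c := nseq n true ++ nseq a false ++ take q r.
apply: (@ppm_bitprob_det R x c).
- by case: cE => s sE; rewrite /x sE -catA suffix_suffix.
- rewrite T0 /= /freq.
  have -> : rcons c b = nseq n true ++ nseq a false ++ take q.+1 r.
    by rewrite /c (take_nth false) // -!rcons_cat.
  have h := @occ_reps_ge (nseq n true) r a q.+1 l1 (nseq a false ++ take q r) isT qr.
  apply: (leq_trans h).
  have -> : x = (Sinit m ++ nseq n false ++ r) ++
      nseq n true ++ reps w l1 ++ nseq a false ++ take q r by rewrite /x ctxE -!catA.
  exact: occ_catr.
- apply/eqP; rewrite -leqn0 /freq.
  have -> : rcons c (~~ b) = nseq n true ++ nseq a false ++ rcons (take q w) (~~ b).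
    by rewrite /c tw -!rcons_cat.
  (* Completing the current repetition gives a text made of whole repetitions and cannot lower the
     count. *)
  apply: (@leq_trans (occ (Sinit m ++ reps w (n :: rcons l1 a))
      (nseq n true ++ nseq a false ++ rcons (take q w) (~~ b)))).
    have -> : Sinit m ++ reps w (n :: rcons l1 a) = x ++ drop q w.
      rewrite /x /rep_context -rcons_cons -(cats1 (n :: l1)) reps_cat (reps_cons _ a).
      by rewrite reps_nil cats0 -tw -!catA cat_take_drop.
    exact: occ_catl.
  have all1 : all (leq 1) (n :: rcons l1 a) by [].
  rewrite occ_noones ?head_reps ?Sinit_noones // occ_reps_conflict ?q0 ?qw //.
  by rewrite bw; case: (b).
Qed.

Definition rep_bound T : R := if T == 0%N then G else T%:R / T.+1%:R.

(** The [a <= n] zeros, the first bit of [w] and the closing [n] ones are bounded by [G] each; the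
    other bits, at most [N], by [ppm_bitprob_rep]. For a gap not in [l1], [G] serves throughout. *)
Lemma ppm_cond_rep l1 a l2 E : Sn n = reps w (n :: l1 ++ a :: l2) ++ E ->
  all (leq 1) (rcons l1 a) -> (a <= n)%N ->
  G ^+ (2 * n).+1 * rep_bound (count_mem a l1) ^+ N <=
  ppm_cond (rep_context l1) (nseq a false ++ w).
Proof.
move=> eS al an; have /andP[G0 G1] := bit_bound_bounds n; rewrite -/G in G0 G1.
have gen Y0 Y Y3 : nseq a false ++ w = Y0 ++ Y ++ Y3 ->
    G ^+ size Y <= ppm_cond (rep_context l1 ++ Y0) Y.
  move=> eY; apply: ppm_cond_ge => [|Y1 b Y2 e]; first exact: ltW.
  rewrite /rep_context -!catA; apply: (@ppm_bitprob_Sn _ _ (Y2 ++ Y3 ++ reps w l2 ++ E)).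
  rewrite eS -cat_cons reps_cat (reps_cons _ a) [nseq a _ ++ _]catA eY e.
  by rewrite -!catA.
have swN : (size w <= N)%N by rewrite -sw leq_addl.
rewrite /rep_bound; case: eqP => [_|/eqP T0].
  have := gen [::] (nseq a false ++ w) [::]; rewrite !cats0 => /(_ erefl) h.
  apply: (le_trans _ h); rewrite -exprD ler_wiXn2l // ?ltW //.
  by rewrite size_cat size_nseq; lia.
set T := count_mem a l1 in T0 *.
have wE : nseq a false ++ w =
    (nseq a false ++ take 1 r) ++ drop 1 r ++ nseq n true.
  by rewrite /w -[in LHS](cat_take_drop 1 r) -!catA.
have rho : 0 < (T%:R / T.+1%:R : R) <= 1.
  rewrite divr_gt0 ?ltr0n ?lt0n //= ler_pdivrMr ?ltr0n // mul1r ler_nat leqnSn.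
  by [].
have /andP[r0 r1] := rho.
rewrite wE ppm_cond_cat [ppm_cond _ (drop 1 r ++ _)]ppm_cond_cat.
have h1 : G ^+ n.+1 <= ppm_cond (rep_context l1) (nseq a false ++ take 1 r).
  have := gen [::] (nseq a false ++ take 1 r) _ wE; rewrite cats0 => h.
  apply: (le_trans _ h); rewrite ler_wiXn2l // ?ltW //.
  by rewrite size_cat size_nseq size_take; case: ifP; lia.
have h3 : G ^+ n <=
    ppm_cond ((rep_context l1 ++ nseq a false ++ take 1 r) ++ drop 1 r) (nseq n true).
  have := gen ((nseq a false ++ take 1 r) ++ drop 1 r) (nseq n true) [::].
  by rewrite size_nseq -!catA cats0 wE -!catA => /(_ erefl).
have h2 : (T%:R / T.+1%:R) ^+ N <= ppm_cond (rep_context l1 ++ nseq a false ++ take 1 r) (drop 1 r).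
  apply: (@le_trans _ _ ((T%:R / T.+1%:R) ^+ size (drop 1 r))).
    rewrite ler_wiXn2l // ?ltW // size_drop.
    by move: swN; rewrite size_cat; lia.
  apply: ppm_cond_ge => [|Y1 b Y2 e]; first exact: ltW.
  have rE : r = take 1 r ++ Y1 ++ b :: Y2 by rewrite -e cat_take_drop.
  have s1 : size (take 1 r) = 1%N.
    by move/(congr1 size): (e); rewrite size_drop size_take size_cat /=; case: ifP; lia.
  have qr : (0 < (size Y1).+1 < size r)%N.
    by rewrite [in size r]rE !size_cat s1 /=; lia.
  have tE : take (size Y1).+1 r = take 1 r ++ Y1.
    by rewrite {1}rE catA take_size_cat // size_cat s1.
  have bE : nth false r (size Y1).+1 = b.
    by rewrite rE catA nth_cat size_cat s1 ltnn subnn.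
  have := ppm_bitprob_rep al _ qr; rewrite tE bE -!catA; apply.
  by rewrite lt0n.
have -> : G ^+ (2 * n).+1 * (T%:R / T.+1%:R) ^+ N =
    G ^+ n.+1 * ((T%:R / T.+1%:R) ^+ N * G ^+ n).
  by rewrite [RHS]mulrCA -exprD [LHS]mulrC; congr (_ * _ ^+ _); lia.
have gG k : 0 <= G ^+ k by apply/exprn_ge0/ltW.
have gr : 0 <= (T%:R / T.+1%:R) ^+ N :> R by apply/exprn_ge0/ltW.
by apply: ler_pM => //; [apply: mulr_ge0|apply: ler_pM].
Qed.

(* [rep_bound T = rep_weight T.+1 / rep_weight T], so the product of the
   bounds over the repetitions telescopes. *)
Definition rep_weight T : R := if T == 0%N then 1 else G / T%:R.

Definition rep_weights l := rep_weight (count_mem n l) * rep_weight (count_mem m l).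

Lemma rep_weightS T : rep_bound T * rep_weight T = rep_weight T.+1.
Proof.
rewrite /rep_bound /rep_weight; case: eqP => [->|/eqP T0] /=; first by rewrite mulr1 divr1.
have T1 : T%:R != 0 :> R by rewrite pnatr_eq0.
have T2 : T.+1%:R != 0 :> R by rewrite pnatr_eq0.
by rewrite mulrC mulrA mulfVK.
Qed.

Lemma rep_weights_rcons l a : (a == n) || (a == m) ->
  rep_bound (count_mem a l) * rep_weights l = rep_weights (rcons l a).
Proof.
have nm : (m == n) = false by rewrite /n; apply/eqP; lia.
rewrite /rep_weights -cats1 !count_cat /= => /orP[] /eqP ->;
  rewrite eqxx ?nm 1?eq_sym ?nm !addn0 addn1.
  by rewrite mulrA rep_weightS.
by rewrite mulrCA rep_weightS.
Qed.

(** Since [T <= n], also [1 / T >= G]: after telescoping, all repetitions with one gap together cost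
    no more per position of [w] than two bits of probability [G]. *)
Lemma rep_weight_ge T : (T <= n)%N -> G ^+ 2 <= rep_weight T.
Proof.
have /andP[G0 G1] := bit_bound_bounds n; rewrite -/G in G0 G1.
move=> Tn; rewrite /rep_weight; case: eqP => [_|/eqP T0]; first by rewrite exprn_ile1 // ltW.
rewrite expr2 ler_pM2l // /G /bit_bound lef_pV2 ?posrE ?ltr0n ?expn_gt0 ?lt0n //.
by rewrite ler_nat; apply: leq_trans Tn _; clear; rewrite /count_bound; nia.
Qed.

Lemma rep_weights_ge0 l : 0 <= rep_weights l.
Proof.
have /andP[G0 _] := bit_bound_bounds n.
rewrite /rep_weights /rep_weight mulr_ge0 //; case: ifP => _;
  by rewrite ?divr_ge0 ?ler0n // ltW.
Qed.

(** The factor [rep_weights l1] on the right lets the induction on [l2] start from any history;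
    [rep_weights_rcons] turns each new bound into a change of weight. *)
Lemma ppm_cond_reps l1 l2 E : Sn n = reps w (n :: l1 ++ l2) ++ E ->
  all (leq 1) (l1 ++ l2) -> all (fun a => (a == n) || (a == m)) l2 ->
  G ^+ ((2 * n).+1 * size l2) * rep_weights (l1 ++ l2) ^+ N <=
  ppm_cond (rep_context l1) (reps w l2) * rep_weights l1 ^+ N.
Proof.
have /andP[G0 G1] := bit_bound_bounds n; rewrite -/G in G0 G1.
elim: l2 l1 => [|a l2 IH] l1 eS al; first by rewrite muln0 expr0 cats0 mul1r.
move=> /andP[anm h2]; rewrite reps_cons catA ppm_cond_cat.
have cE : rep_context l1 ++ nseq a false ++ w = rep_context (rcons l1 a).
  rewrite /rep_context -rcons_cons -cats1 reps_cat (reps_cons _ a) reps_nil cats0.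
  by rewrite -!catA.
have al1 : all (leq 1) (rcons l1 a) by move: al; rewrite -cat_rcons all_cat => /andP[].
have an : (a <= n)%N by case/orP: anm => /eqP ->; rewrite // leqnSn.
have h := ppm_cond_rep eS al1 an.
have := IH (rcons l1 a); rewrite !cat_rcons => /(_ eS al h2) ih.
rewrite cE -rep_weights_rcons // [(_ * rep_weights l1) ^+ N]exprMn in ih *.
set P := ppm_cond (rep_context (rcons l1 a)) _ in ih *.
have P0 : 0 <= P by have /andP[/ltW] := ppm_cond_bounds (rep_context (rcons l1 a)) (reps w l2).
apply: (@le_trans _ _ ((G ^+ (2 * n).+1 * rep_bound (count_mem a l1) ^+ N) *
    P * rep_weights l1 ^+ N)); last first.
  by rewrite !ler_wpM2r ?exprn_ge0 ?rep_weights_ge0.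
have -> : ((2 * n).+1 * size (a :: l2) = (2 * n).+1 + (2 * n).+1 * size l2)%N.
  by rewrite -mulnS.
move: (2 * n).+1 ih => k ih; rewrite exprD -!mulrA ler_wpM2l ?exprn_ge0 ?(ltW G0) //.
by rewrite (mulrCA (_ ^+ N)).
Qed.

End Block.

Lemma sqr_le_exp n : (n * n <= 2 * 2 ^ n)%N.
Proof.
case: n => [|[|[|n]]] //; elim: n => // n IH; rewrite expnS.
by move: (2 ^ n.+3)%N IH => p IH; nia.
Qed.

(** With [n = m + 1] and [N = 2^n], the exponent collects [N] for the first repetition, [4 * N] for
    the two final weights, and [(2 * n + 1) * m + n <= 2 * n^2 <= 4 * N] for the bits bounded
    separately and the trailing zeros. *)
Lemma ppm_cond_Sn m : (1 < m)%N ->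
  bit_bound m.+1 ^+ (9 * 2 ^ m.+1) <= ppm_cond (Sinit m) (Sn m.+1).
Proof.
move=> m2; have [r] := db_data m; set w := _ ++ _ => -[dE hw o1 sw _].
have [l [e [eS sl al en]]] := Sn_reps (ltn0Sn m) dE.
have al1 := all_reps (ltn0Sn m) sl al.
set G := bit_bound m.+1; set N := (2 ^ m.+1)%N.
have /andP[G0 G1] := bit_bound_bounds m.+1; rewrite -/G in G0 G1.
have gen Y0 Y Y3 : Sn m.+1 = Y0 ++ Y ++ Y3 -> G ^+ size Y <= ppm_cond (Sinit m ++ Y0) Y.
  move=> eY; apply: ppm_cond_ge => [|Y1 b Y2 eY1]; first exact: ltW.
  rewrite -!catA; apply: (@ppm_bitprob_Sn m m2 _ _ (Y2 ++ Y3)).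
  by rewrite eY eY1 -!catA.
have SE : Sn m.+1 = (nseq m.+1 false ++ w) ++ reps w l ++ nseq e false.
  by rewrite eS reps_cons -!catA.
rewrite SE ppm_cond_cat [ppm_cond _ (reps w l ++ _)]ppm_cond_cat.
have h1 : G ^+ N <= ppm_cond (Sinit m) (nseq m.+1 false ++ w).
  have := gen [::] _ _ SE; rewrite cats0; congr (_ ^+ _ <= _).
  by rewrite size_cat size_nseq.
have h3 : G ^+ m.+1 <=
    ppm_cond ((Sinit m ++ nseq m.+1 false ++ w) ++ reps w l) (nseq e false).
  have := gen ((nseq m.+1 false ++ w) ++ reps w l) (nseq e false) [::].
  rewrite cats0 -catA => /(_ SE); rewrite size_nseq -!catA => h; apply: (le_trans _ h).
  by rewrite ler_wiXn2l // ?ltW // ltnW.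
have h2 : G ^+ ((2 * m.+1).+1 * m + 4 * N) <=
    ppm_cond (Sinit m ++ nseq m.+1 false ++ w) (reps w l).
  have := @ppm_cond_reps m m2 r hw o1 sw [::] l (nseq e false) eS _ al.
  move: al1 => /= -> /(_ isT).
  rewrite {2}/rep_weights /rep_weight mulr1 expr1n mulr1.
  rewrite /rep_context reps_cons reps_nil cats0 => h.
  apply: (le_trans _ h); rewrite exprD; have -> : size l = m by case: sl.
  rewrite ler_wpM2l ?exprn_ge0 ?(ltW G0) // exprM.
  rewrite lerXn2r ?nnegrE ?exprn_ge0 ?(ltW G0) ?rep_weights_ge0 //.
  rewrite (exprD G 2 2) /rep_weights ler_pM ?exprn_ge0 ?(ltW G0) //.
    by apply: rep_weight_ge => //; apply: leq_trans (count_size _ _) _; rewrite -ltnS sl.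
  by apply: rep_weight_ge => //; apply: leq_trans (count_size _ _) _; rewrite -ltnS sl.
apply: (@le_trans _ _ (G ^+ N * (G ^+ ((2 * m.+1).+1 * m + 4 * N) * G ^+ m.+1))).
  rewrite -!exprD ler_wiXn2l // ?ltW //.
  have := sqr_le_exp m.+1; rewrite -/N => h; nia.
apply: ler_pM; rewrite ?mulr_ge0 ?exprn_ge0 ?(ltW G0) //.
by apply: ler_pM; rewrite ?exprn_ge0 ?(ltW G0).
Qed.

End CondProb.

(** * The limit *)

Lemma Sinit_prefix n m : n <= m -> prefix (Sinit n) (Sinit m).
Proof.
move=> nm; rewrite -(subnKC nm); elim: (m - n) => [|d IH].
  by rewrite addn0 prefix_refl.
by rewrite addnS SinitS; apply: prefix_trans IH (prefix_prefix _ _).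
Qed.

Lemma size_Sinit_ge n : n <= size (Sinit n).
Proof.
elim: n => // n IH; rewrite SinitS size_cat size_Sn //.
have : 0 < 2 ^ n.+1 by rewrite expn_gt0.
by move: (2 ^ _) => p; nia.
Qed.

(** Choosing [n] least makes [m] exceed the length of [Sinit n.-1], against which the cost of all of
    [Sinit n] is measured. *)
Lemma Sprefix_Sinit m : exists n,
  [/\ Sprefix m = take m (Sinit n), m <= size (Sinit n) & 0 < n -> size (Sinit n.-1) < m].
Proof.
have [n mn nmin] := ex_minnP (ex_intro (fun n => m <= size (Sinit n)) m (size_Sinit_ge m)).
exists n; split=> // [|n0].
  have /prefixP[s sE] := Sinit_prefix (nmin m (size_Sinit_ge m)).
  by rewrite /Sprefix -/(Sinit m) sE takel_cat.
rewrite ltnNge; apply/negP => /nmin; lia.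
Qed.

Lemma size_Sinit_exp k : k * 2 ^ k <= size (Sinit k).
Proof. by case: k => // k; rewrite SinitS size_cat size_Sn // leq_addl. Qed.

Section Limit.
Variable R : realType.
Local Open Scope ring_scope.

Lemma ppm_prob_gt0 y : 0 < ppm_prob R y.
Proof. by rewrite ppm_probE; have /andP[] := ppm_cond_bounds R [::] y. Qed.

Lemma ppm_prob_cat x y : ppm_prob R (x ++ y) = ppm_prob R x * ppm_cond R x y.
Proof. by rewrite !ppm_probE ppm_cond_cat. Qed.

Definition bit_cost n : R := ln ((count_bound n).+2 ^ 2)%:R.

Lemma bit_cost_le n p : (n <= p)%N -> bit_cost n <= bit_cost p.
Proof.
move=> np; rewrite /bit_cost ler_ln ?posrE ?ltr0n ?expn_gt0 // ler_nat.
rewrite leq_exp2r // !ltnS /count_bound.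
by rewrite !(leq_mul, leq_add, leq_mul2l, leq_add2l) ?np ?orbT.
Qed.

Lemma bit_cost_ge0 n : 0 <= bit_cost n.
Proof. by rewrite /bit_cost ln_ge0 // ler1n expn_gt0. Qed.

(** [C] is the cost of [S_1 S_2], which [ppm_cond_Sn] does not reach. The coefficient 18 reproduces
    itself: [18 * 2^m = 9 * 2^(m+1)], and the next block adds another [9 * 2^(m+1)]. *)
Lemma cost_Sinit : exists2 C : R, 0 <= C & forall n, (1 < n)%N ->
  - ln (ppm_prob R (Sinit n)) <= C + 18 * (2 ^ n)%:R * bit_cost n.
Proof.
have p1 : ppm_prob R (Sinit 2) <= 1.
  by rewrite ppm_probE; have /andP[] := ppm_cond_bounds R [::] (Sinit 2).
exists (- ln (ppm_prob R (Sinit 2))).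
  by rewrite oppr_ge0 -ln1 ler_ln ?posrE ?ppm_prob_gt0.
elim=> // -[|[|n]] // IH _.
  by rewrite lerDl !mulr_ge0 ?bit_cost_ge0.
have {}IH := IH isT; set m := n.+2 in IH *.
have /andP[c0 _] := ppm_cond_bounds R (Sinit m) (Sn m.+1).
rewrite SinitS ppm_prob_cat lnM ?posrE ?ppm_prob_gt0 // opprD.
have h := ppm_cond_Sn R (ltn0Sn n : (1 < m)%N).
have /andP[G0 _] := bit_bound_bounds R m.+1.
have {}h : - ln (ppm_cond R (Sinit m) (Sn m.+1)) <= 9 * (2 ^ m.+1)%:R * bit_cost m.+1.
  have h2 : ln (bit_bound R m.+1 ^+ (9 * 2 ^ m.+1)) <= ln (ppm_cond R (Sinit m) (Sn m.+1)).
    by rewrite ler_ln ?posrE ?exprn_gt0.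
  rewrite lnXn // /bit_bound lnV ?posrE ?ltr0n ?expn_gt0 // -/(bit_cost m.+1) in h2.
  by rewrite -natrM mulr_natl; move: h2; rewrite mulNrn; lra.
have b := bit_cost_le (leqnSn m).
have b' : 18 * (2 ^ m)%:R * bit_cost m <= 9 * (2 ^ m.+1)%:R * bit_cost m.+1.
  have -> : 9 * (2 ^ m.+1)%:R = 18 * (2 ^ m)%:R :> R by rewrite expnS natrM; lra.
  by rewrite ler_wpM2l ?mulr_ge0.
move: IH h b'; set x := - ln _; set y := - ln _; set z := - ln _; lra.
Qed.

(** For [n >= 20] the cubic [count_bound n + 2] is at most [n^4], so the argument of [ln] is at most
    [n^8], the 16th power of the root of [n]; then [ln x <= x] applies. *)
Lemma bit_cost_sqrt n : (20 <= n)%N -> bit_cost n <= 16 * Num.sqrt n%:R.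
Proof.
move=> n20; have n0 : 0 < n%:R :> R by rewrite ltr0n; lia.
have s0 : 0 < Num.sqrt n%:R :> R by rewrite sqrtr_gt0.
have h : ((count_bound n).+2 ^ 2 <= (n ^ 4) ^ 2)%N.
  by rewrite leq_exp2r // /count_bound !expnS expn0; clear n0 s0; nia.
apply: (@le_trans _ _ (ln (Num.sqrt n%:R ^+ 16))).
  rewrite /bit_cost ler_ln ?posrE ?exprn_gt0 ?ltr0n ?expn_gt0 //.
  have -> : Num.sqrt n%:R ^+ 16 = ((n ^ 4) ^ 2)%:R :> R.
    by rewrite !natrX -exprM -[16%N]/(2 * 8)%N exprM sqr_sqrtr // ltW.
  by rewrite ler_nat.
rewrite lnXn // -[ln _ *+ 16]mulr_natl ler_pM2l ?ltr0n //.
exact/ltW/ln_sublinear.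
Qed.

Lemma bit_cost_small (e : R) : 0 < e -> exists k0, forall k, (k0 <= k)%N ->
  36 * bit_cost k.+1 <= e * k%:R.
Proof.
(* With [s] the root of [k + 1], the cost is at most [36 * 16 * s = 576 * s], while
   [k = (s - 1) * (s + 1)]; hence [s >= 576 / e + 1] suffices. *)
move=> e0; set A := 576 / e + 1.
have A1 : 1 <= A by rewrite lerDr divr_ge0 // ltW.
exists (maxn 20 (Num.bound (A ^+ 2))) => k; rewrite geq_max => /andP[k20 kA].
have h := bit_cost_sqrt (leqW k20); set s := Num.sqrt _ in h.
have s2 : s ^+ 2 = k.+1%:R by rewrite sqr_sqrtr.
have As : A <= s.
  have A0 : 0 <= A by lra.
  rewrite -(ger0_norm A0) -sqrtr_sqr ler_wsqrtr //.
  have := archi_boundP (exprn_ge0 2 A0) => /ltW /le_trans; apply.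
  by rewrite ler_nat leqW.
have kE : k%:R = (s - 1) * (s + 1) :> R.
  have : k%:R = s ^+ 2 - 1 by rewrite s2 -natr1; lra.
  by move=> ->; rewrite expr2; lra.
have h1 : 576 <= e * (s - 1).
  have -> : 576 = e * (A - 1) by rewrite /A addrK mulrC divfK ?gt_eqF.
  by rewrite ler_pM2l // lerD2r.
rewrite kE mulrA; have : 576 * (s + 1) <= e * (s - 1) * (s + 1).
  by rewrite ler_wpM2r //; lra.
lra.
Qed.

End Limit.

Local Open Scope ring_scope.

(* For any realization L of the arithmetic code, i.e. any code-length function
   with |PPM*(y)| <= -log P(y) + O(1), the worst-case compression ratio
   limsup_m |PPM*(S|^m)|/m of PPM* on S is 0. *)
Theorem theorem2 (R : realType) (L : seq bool -> nat) (c : R) :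
  (forall y : seq bool, (L y)%:R <= - log2 (ppm_prob R y) + c) ->
  limn_esup (fun m : nat => ((L (Sprefix m))%:R / m%:R : R)%:E) = 0%E.
Proof.
move=> hL; have [C C0 hC] := cost_Sinit R.
have l2 : 0 < ln 2 :> R by rewrite ln_gt0 // ltr1n.
have cvg0 : ((fun m : nat => (L (Sprefix m))%:R / m%:R : R) @ \oo --> (0 : R))%classic.
  apply/cvgrPdist_le => e e0.
  (* Half of [e] pays for the growing cost, with [ln 2] converting to bits; the other half pays for
     the constants gathered in [D] once [m >= M]. *)
  have e20 : 0 < e * ln 2 / 2 by rewrite divr_gt0 ?mulr_gt0.
  have [k0 hk0] := bit_cost_small e20.
  set D := C / ln 2 + `|c|; set M := Num.bound (2 * D / e).
  have D0 : 0 <= D by rewrite addr_ge0 ?divr_ge0 // ltW.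
  near=> m.
  have m0 : (0 < m)%N by near: m; exists 1%N.
  have mM : (M <= m)%N by near: m; exists M.
  have mS : (size (Sinit k0.+1) < m)%N by near: m; exists (size (Sinit k0.+1)).+1.
  rewrite sub0r normrN ger0_norm ?divr_ge0 // ler_pdivrMr ?ltr0n //.
  have [n [SE mn nm]] := Sprefix_Sinit m.
  have kn : (k0.+1 < n)%N.
    rewrite ltnNge; apply/negP => nk; have /prefixP[s sE] := Sinit_prefix nk.
    by move: mS; rewrite sE size_cat; lia.
  case: n SE mn nm kn => // k SE mn /(_ isT) /= km kn.
  apply: (le_trans (hL _)); rewrite /log2.
  (* Reading on only lowers the probability, so the prefix costs no more than all of
     [Sinit k.+1]. *)
  have pge : ppm_prob R (Sinit k.+1) <= ppm_prob R (Sprefix m).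
    rewrite SE -{1}(cat_take_drop m (Sinit k.+1)) ppm_prob_cat.
    have /andP[_ h] := ppm_cond_bounds R (take m (Sinit k.+1)) (drop m (Sinit k.+1)).
    by rewrite ler_piMr // ltW // ppm_prob_gt0.
  have cost : - ln (ppm_prob R (Sprefix m)) <= C + e * ln 2 / 2 * m%:R.
    apply: (@le_trans _ _ (- ln (ppm_prob R (Sinit k.+1)))).
      by rewrite lerN2 ler_ln ?posrE ?ppm_prob_gt0.
    apply: (le_trans (hC _ _)); first by lia.
    (* [S_k] alone has [k * 2 ^ k] bits and ends before [m]; its factor [k] outweighs the
       logarithmic [bit_cost]. *)
    rewrite lerD2l; apply: (@le_trans _ _ (e * ln 2 / 2 * (k * 2 ^ k)%:R)).
      have := hk0 k; rewrite -ltnS => /(_ (ltnW kn)) h.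
      have -> : 18 * (2 ^ k.+1)%:R * bit_cost R k.+1 =
          (2 ^ k)%:R * (36 * bit_cost R k.+1) by rewrite expnS natrM; lra.
      by rewrite natrM [leRHS]mulrA [leRHS]mulrC ler_wpM2l.
    rewrite ler_pM2l // ler_nat; apply: leq_trans (ltnW km).
    exact: size_Sinit_exp.
  have Dm : D <= e / 2 * m%:R.
    have h : 2 * D / e <= m%:R.
      apply: (@le_trans _ _ M%:R); last by rewrite ler_nat.
      by apply/ltW/archi_boundP; rewrite divr_ge0 ?mulr_ge0 // ltW.
    by move: h; rewrite ler_pdivrMr //; lra.
  have c1 := ler_norm c.
  have h1 : - (ln (ppm_prob R (Sprefix m)) / ln 2) <= C / ln 2 + e / 2 * m%:R.
    rewrite -mulNr ler_pdivrMr // mulrDl divfK ?gt_eqF //.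
    by apply: (le_trans cost); rewrite lerD2l; lra.
  by move: Dm; rewrite /D; lra.
have cvgE : ((fun m : nat => ((L (Sprefix m))%:R / m%:R : R)%:E) @ \oo --> 0%:E)%classic.
  by apply: cvg_EFin => //; near=> m.
by rewrite is_cvg_limn_esupE; [exact: cvg_lim|apply/cvg_ex; exists 0%:E].
Unshelve. all: by end_near.
Qed.
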